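(* Let $X$ be an irreducible Markov chain with transition matrix $P$ and stationary distribution $\mu$ on the finite connected graph $G=(V,E)$, and consider its associated electric network. Let $a\ne b$ be vertices and let $k$ be a real cost function assigning $k_{xy}$ to each ordered pair $(x,y)$ with $x\sim y$ (no relation between $k_{xy}$ and $k_{yx}$ is assumed). Then the expected commute cost $K^k_{ab}$ is $$K^k_{ab}=R^{\text{eff}}_{ab}\cdot D^k,\qquad\text{where } D^k=\sum_{x\in V}\sum_{y\sim x}D_{xy}\gamma_{xy}k_{xy}.$$
   Context: Graphs are finite, connected and undirected, and loops are allowed; $x\sim y$ means that $x$ and $y$ are joined by an edge, with $x\sim x$ exactly when $x$ has a loop. A Markov chain on $G=(V,E)$ has $P_{xy}>0$ if and only if $x\sim y$; it need not be reversible. With $\tau^0_b=\inf\{t\ge0:X(t)=b\}$, the expected cost from $a$ to $b$ is $H^k_{ab}=\mathbf E_a\sum_{t=1}^{\tau^0_b}k_{X(t-1)X(t)}$ (an empty sum is $0$), where $\mathbf E_a$ is expectation for the chain started from $a$, and the expected commute cost is $K^k_{ab}=H^k_{ab}+H^k_{ba}$. An electric network on $G$ consists of resistances $R_{xy}=R_{yx}>0$ and amplifier parameters $\lambda_{xy}>0$ with $\lambda_{yx}=1/\lambda_{xy}$ for $x\sim y$, with $\lambda_{xx}=1$ on loops. Put $C_{xy}=1/R_{xy}$, $\gamma_{xy}=\sqrt{\lambda_{xy}}=1/\gamma_{yx}$, $D_{xy}=\frac{2\gamma_{xy}}{1+\lambda_{xy}}C_{xy}=D_{yx}$. The network associated with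 the chain is the one with $D_{xy}=\sqrt{\mu_xP_{xy}\mu_yP_{yx}}$ and $\gamma_{xy}=\sqrt{\mu_xP_{xy}/(\mu_yP_{yx})}$. Potentials $(u_x)_{x\in V}$ and currents are related by $i_{xy}=D_{xy}(\gamma_{yx}u_x-\gamma_{xy}u_y)$. The incoming current to vertex $x$ is $i_x=\sum_{y\sim x}i_{xy}$; $x$ is free if $i_x=0$. For potentials prescribed on a nonempty set of vertices, with all others free, there is a unique solution $(u,i)$. Hold $a$ at potential $U_a$, $b$ at potential $U_b$, with all other vertices free. In the network associated with a chain there is a constant $R^{\text{eff}}_{ab}>0$, the effective resistance between $a$ and $b$, with $U_a-U_b=R^{\text{eff}}_{ab}\, i_a$ for all $U_a,U_b\in\mathbb R$. *)

(* Defs.v *)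
From mathcomp Require Import all_boot all_order all_algebra.
From mathcomp Require Import all_classical all_reals all_analysis.

Set Implicit Arguments.
Unset Strict Implicit.
Unset Printing Implicit Defensive.

Import Order.TTheory GRing.Theory Num.Theory.

Local Open Scope classical_set_scope.
Local Open Scope ring_scope.

(* Loops are allowed: [e] need not be irreflexive. *)
Definition connected_graph (V : finType) (e : rel V) : Prop :=
  symmetric e /\ forall x y : V, connect e x y.

Definition transition_matrix (R : realType) (V : finType) (P : V -> V -> R) :
    Prop :=
  (forall x y, 0 <= P x y) /\ (forall x, \sum_y P x y = 1).

Definition chain_on_graph (R : realType) (V : finType) (e : rel V)
    (P : V -> V -> R) : Prop :=
  transition_matrix P /\ forall x y, 0 < P x y <-> e x y.

Definition irreducible_chain (R : realType) (V : finType) (P : V -> V -> R) :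
    Prop :=
  forall x y : V, connect (fun v w => 0 < P v w) x y.

Definition stationary_distribution (R : realType) (V : finType)
    (P : V -> V -> R) (mu : V -> R) : Prop :=
  [/\ forall x, 0 <= mu x, \sum_x mu x = 1
    & forall y, \sum_x mu x * P x y = mu y].

(* The Markov property is written in multiplied-out form, so that nothing is
   conditioned on a null event. *)
Definition markov_chain_from (R : realType) (V : finType) (P : V -> V -> R)
    (d : measure_display) (Omega : measurableType d)
    (Pr : probability Omega R) (X : nat -> Omega -> V) (a : V) : Prop :=
  [/\ forall t x, measurable (X t @^-1` [set x]),
      Pr [set w | X 0%N w = a] = 1%E
    & forall (n : nat) (s : nat -> V),
        Pr [set w | forall t, (t <= n.+1)%N -> X t w = s t] =
        (Pr [set w | forall t, (t <= n)%N -> X t w = s t]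
          * (P (s n) (s n.+1))%:E)%E].

(* [Pr a] is the law under which the chain [X] is started from [a]; it plays
   the role of the subscript in E_a. *)
Definition markov_family (R : realType) (V : finType) (P : V -> V -> R)
    (d : measure_display) (Omega : measurableType d)
    (Pr : V -> probability Omega R) (X : nat -> Omega -> V) : Prop :=
  forall a : V, markov_chain_from P (Pr a) X a.

(* [None] stands for the infimum of the empty set. *)
Definition hitting_time (V : finType) (s : nat -> V) (b : V) : option nat :=
  if pselect (exists t : nat, s t == b) is left h then Some (ex_minn h)
  else None.

(* A trajectory that never visits [b] gets the arbitrary value 0. Those
   trajectories form a null event for an irreducible finite chain. *)
Definition cost_until (R : realType) (V : finType) (k : V -> V -> R) (b : V)
    (s : nat -> V) : R :=
  if hitting_time s b is Some tau then
    \sum_(1 <= t < tau.+1) k (s t.-1) (s t)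
  else 0.

Definition hitting_cost (R : realType) (V : finType)
    (d : measure_display) (Omega : measurableType d)
    (Pr : V -> probability Omega R) (X : nat -> Omega -> V)
    (k : V -> V -> R) (a b : V) : \bar R :=
  'E_(Pr a)[fun w => cost_until k b (fun t => X t w)].

(* An equation between this value and a real number also says that both
   expectations are finite, since [+oo - oo] is [-oo] in [\bar R]. *)
Definition commute_cost (R : realType) (V : finType)
    (d : measure_display) (Omega : measurableType d)
    (Pr : V -> probability Omega R) (X : nat -> Omega -> V)
    (k : V -> V -> R) (a b : V) : \bar R :=
  (hitting_cost Pr X k a b + hitting_cost Pr X k b a)%E.

(* Functions of two vertices are total; only their values on edges matter. *)
Record network (R : realType) (V : finType) (e : rel V) := Network {
  resistance : V -> V -> R;
  amplifier : V -> V -> R;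
  resistance_gt0 : forall x y, e x y -> 0 < resistance x y;
  resistance_sym : forall x y, e x y -> resistance x y = resistance y x;
  amplifier_gt0 : forall x y, e x y -> 0 < amplifier x y;
  amplifierV : forall x y, e x y -> amplifier y x = (amplifier x y)^-1;
  amplifier_loop : forall x, e x x -> amplifier x x = 1
}.

Section Network.
Context (R : realType) (V : finType) (e : rel V) (N : network R e).

Definition conductance (x y : V) : R := (resistance N x y)^-1.

Definition gam (x y : V) : R := Num.sqrt (amplifier N x y).

Definition Dcond (x y : V) : R :=
  2 * gam x y / (1 + amplifier N x y) * conductance x y.

Definition current (u : V -> R) (x y : V) : R :=
  Dcond x y * (gam y x * u x - gam x y * u y).

Definition incoming_current (u : V -> R) (x : V) : R :=
  \sum_(y | e x y) current u x y.

Definition free_vertex (u : V -> R) (x : V) : Prop :=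
  incoming_current u x = 0.

Definition held_potentials (a b : V) (Ua Ub : R) (u : V -> R) : Prop :=
  [/\ u a = Ua, u b = Ub
    & forall x, x != a -> x != b -> free_vertex u x].

Definition is_effective_resistance (a b : V) (r : R) : Prop :=
  0 < r /\ forall (Ua Ub : R) (u : V -> R), held_potentials a b Ua Ub u ->
    Ua - Ub = r * incoming_current u a.

(* The value 0 is taken only if no such constant exists. *)
Definition effective_resistance (a b : V) : R :=
  xget 0 [set r | is_effective_resistance a b r].

Definition total_cost (k : V -> V -> R) : R :=
  \sum_x \sum_(y | e x y) Dcond x y * gam x y * k x y.

Definition associated_network (P : V -> V -> R) (mu : V -> R) : Prop :=
  forall x y, e x y ->
    Dcond x y = Num.sqrt (mu x * P x y * (mu y * P y x)) /\
    gam x y = Num.sqrt (mu x * P x y / (mu y * P y x)).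

End Network.

(* Main.v *)
From HB Require Import structures.
Require Import Defs.
From mathcomp Require Import all_boot all_order all_algebra.
From mathcomp Require Import all_classical all_reals all_analysis.
From mathcomp Require Import measurable_realfun ring lra.

Set Implicit Arguments.
Unset Strict Implicit.
Unset Printing Implicit Defensive.

(** The two hitting costs are values of functions that solve a linear system,
    and their difference is a potential of the network.

    Write [P u] for the mean of [u] after one step. In the network associated
    with the chain, [Dcond x y * gam x y = mu x * P x y], so the current coming
    into [x] is [mu x * (u x - (P u) x)] ([incoming_currentE]): a vertex is free
    exactly when the potential is [P]-harmonic there. Likewise
    [total_cost N k] is the sum of [mu x * c x], where [c x] is the mean cost of
    the first step from [x] ([total_costE]).

    Let [fb] solve [fb b = 0] and [fb = c + P fb] off [b], and let [fa] be its
    analogue for [a]. Then [fb - fa] is harmonic off [a] and [b], its potential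
    drop from [a] to [b] is [fb a + fa b], and, because [mu] integrates
    [fa - P fa] to 0, the current that it draws at [a] is the total cost
    ([hitting_difference_current]). Ohm's law between [a] and [b] therefore says
    [fb a + fa b = effective_resistance N a b * total_cost N k]. That an
    effective resistance exists follows from the unit cost [c = 1], whose
    potential has a positive drop and unit current, and from the maximum
    principle, by which every other potential held at [a] and [b] is an affine
    image of it ([effective_resistanceP]).

    It remains to see that [fb a] is the expected cost from [a] to [b]
    ([expected_cost_until]). The chain killed at [b] has at time [t] a
    subprobability law [q t], the [killed_law]; the Markov property gives its recursion, and the
    expected cost of the first [n] steps, none counted after [b] is reached,
    telescopes to [fb a] minus the integral of [fb] against [q n]. For [c = 1]
    this bounds the sum over [t] of the masses of [q t], hence these masses tend
    to 0, the chain reaches [b] almost surely, and dominated convergence passes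
    to the limit. *)

Import Order.TTheory GRing.Theory Num.Theory.
Import numFieldNormedType.Exports.

Local Open Scope classical_set_scope.
Local Open Scope ring_scope.

(** * Harmonic functions and hitting equations *)

Section PotentialTheory.
Context (R : realType) (V : finType) (P : V -> V -> R).
Hypotheses (hP : transition_matrix P) (hirr : irreducible_chain P).

Definition transition_mean (u : V -> R) (x : V) : R := \sum_y P x y * u y.

(** First-step analysis: with [c x] the mean cost of a step from [x], the
    expected costs of reaching [b] satisfy these equations. *)
Definition hitting_equations (c : V -> R) (b : V) (f : V -> R) : Prop :=
  f b = 0 /\ forall x, x != b -> f x = c x + transition_mean f x.

Lemma transition_mean_cst (r : R) (x : V) : transition_mean (fun=> r) x = r.
Proof. by rewrite /transition_mean -mulr_suml hP.2 mul1r. Qed.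

Lemma transition_meanD (u v : V -> R) (x : V) :
  transition_mean (fun y => u y + v y) x =
  transition_mean u x + transition_mean v x.
Proof.
by rewrite -big_split; apply: eq_bigr => y _; rewrite mulrDr.
Qed.

Lemma transition_meanZ (r : R) (u : V -> R) (x : V) :
  transition_mean (fun y => r * u y) x = r * transition_mean u x.
Proof. by rewrite mulr_sumr; apply: eq_bigr => y _; rewrite mulrCA. Qed.

Lemma transition_meanN (u : V -> R) (x : V) :
  transition_mean (fun y => - u y) x = - transition_mean u x.
Proof. by rewrite /transition_mean -sumrN; under eq_bigr do rewrite mulrN. Qed.

(** At a point where the largest value is attained outside [B], subharmonicity
    forces the same value at every successor; irreducibility carries it along a
    path that ends in [B]. *)
Lemma maximum_principle (B : pred V) (b : V) (M : R) (v : V -> R) :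
  B b -> (forall x, B x -> v x <= M) ->
  (forall x, ~~ B x -> v x <= transition_mean v x) ->
  forall x, v x <= M.
Proof.
move=> Bb vB vsub x0.
have [x _ vmax0] := arg_maxP v (erefl : predT x0).
have {vmax0} vmax z : v z <= v x by exact: vmax0.
suff vxM : v x <= M by apply: le_trans vxM.
have /connectP [p] := hirr x b.
elim: p x vmax => [|y p IHp] x vmax /=; first by move=> _ <-; exact: vB.
case/andP => Pxy ppath bE.
have [Bx|nBx] := boolP (B x); first exact: vB.
have vyx : v y = v x.
  apply/eqP; rewrite eq_le vmax //=; apply: contraT; rewrite -ltNge => vyx.
  have := vsub _ nBx; rewrite leNgt.
  rewrite -[X in _ < X](transition_mean_cst (v x) x) /transition_mean.
  rewrite (bigD1 y) //= [ltRHS](bigD1 y) //=.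
  rewrite ltr_leD // ?ltr_pM2l //.
  by apply: ler_sum => z _; rewrite ler_wpM2l //; apply: hP.1.
by rewrite -vyx; apply: IHp => // z; rewrite vyx.
Qed.

(** Nonnegative costs make [- f] subharmonic off [b]. *)
Lemma superharmonic_ge0 (c : V -> R) (b : V) (f : V -> R) :
  (forall x, 0 <= c x) -> hitting_equations c b f -> forall x, 0 <= f x.
Proof.
move=> c0 [fb fE] x; rewrite -oppr_le0.
apply: (@maximum_principle (pred1 b) b 0 (fun y => - f y)) => //=.
- by move=> y /eqP ->; rewrite fb oppr0.
- by move=> y yb; rewrite fE // opprD transition_meanN gerDr oppr_le0.
Qed.

Lemma hitting_equations0 (b : V) (f : V -> R) :
  hitting_equations (fun=> 0) b f -> forall x, f x = 0.
Proof.
move=> hf x; apply/eqP; rewrite eq_le.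
apply/andP; split; last exact: superharmonic_ge0 hf x.
rewrite -oppr_ge0; apply: (@superharmonic_ge0 (fun=> 0) b (fun y => - f y)) => //.
case: hf => fb fE; split=> [|y yb]; first by rewrite fb oppr0.
by rewrite fE // !add0r transition_meanN.
Qed.

(** The linear system of the hitting equations on the space of all functions:
    the row of [b] prescribes the value, the others read [f - P f]. *)
Definition hitting_operator (b : V) (f : {ffun V -> R^o}) : {ffun V -> R^o} :=
  [ffun x => if x == b then f b else f x - transition_mean f x].

Lemma hitting_operator_is_linear (b : V) : linear (hitting_operator b).
Proof.
move=> r f g; apply/ffunP => x; rewrite !ffunE; case: eqP => // _.
rewrite /transition_mean.
have -> : \sum_y P x y * (r *: f + g) y
    = r * (\sum_y P x y * f y) + \sum_y P x y * g y.
  rewrite mulr_sumr -big_split; apply: eq_bigr => y _.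
  by rewrite !ffunE /= mulrDr mulrCA.
rewrite scalerBr /GRing.scale /=; ring.
Qed.

HB.instance Definition _ (b : V) :=
  GRing.isLinear.Build R {ffun V -> R^o} {ffun V -> R^o} _
    (hitting_operator b) (hitting_operator_is_linear b).

(** The operator is injective by the maximum principle, hence bijective since
    the space of functions has finite dimension. *)
Lemma hitting_equations_solvable (c : V -> R) (b : V) :
  exists f : V -> R, hitting_equations c b f.
Proof.
have kT : lker (linfun (hitting_operator b)) == 0%VS.
  rewrite -subv0; apply/subvP => f; rewrite memv_ker lfunE /= memv0.
  move=> /eqP/ffunP Tf.
  apply/eqP/ffunP => x; rewrite [RHS]ffunE; apply: (@hitting_equations0 b).
  split; first by have := Tf b; rewrite !ffunE eqxx.
  move=> y yb; have := Tf y; rewrite !ffunE (negbTE yb).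
  by move/eqP; rewrite subr_eq0 => /eqP ->; rewrite add0r.
pose rhs : {ffun V -> R^o} := [ffun x => if x == b then 0 else c x].
have := lker0_lfunVK kT rhs; set f := (linfun (hitting_operator b))^-1%VF rhs.
rewrite lfunE /= => /ffunP fE; exists f; split.
  by have := fE b; rewrite !ffunE eqxx.
move=> x xb; have := fE x; rewrite !ffunE (negbTE xb).
by move=> <-; rewrite subrK.
Qed.

(** Some vertex has mass, since the total is 1, and stationarity transports
    positive mass along transitions of positive probability. *)
Lemma stationary_gt0 (mu : V -> R) (hmu : stationary_distribution P mu) :
  forall x, 0 < mu x.
Proof.
case: hmu => mu0 mu1 muP.
have step x y : 0 < mu x -> 0 < P x y -> 0 < mu y.
  move=> mux Pxy; rewrite -muP (bigD1 x) //=.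
  apply: ltr_pwDl; first exact: mulr_gt0.
  by apply: sumr_ge0 => z _; apply: mulr_ge0 => //; apply: hP.1.
have [x mux] : exists x, 0 < mu x.
  apply: contrapT => /forallNP nmu.
  move: mu1; rewrite big1 => [/eqP|x _]; first by rewrite eq_sym oner_eq0.
  by apply/eqP; rewrite eq_le mu0 andbT leNgt; apply/negP/nmu.
move=> y; have /connectP [p] := hirr x y.
elim: p x mux => [|z p IHp] x mux /=; first by move=> _ ->.
by case/andP => Pxz; apply: IHp; exact: step Pxz.
Qed.

(** Summed against [mu], the Laplacian [u - P u] vanishes: no net current enters
    the network. *)
Lemma stationary_mean (mu : V -> R) (hmu : stationary_distribution P mu)
    (u : V -> R) :
  \sum_x mu x * transition_mean u x = \sum_x mu x * u x.
Proof.
case: hmu => _ _ muP; under eq_bigr do rewrite mulr_sumr.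
rewrite exchange_big; apply: eq_bigr => y _ /=.
by rewrite -muP mulr_suml; apply: eq_bigr => x _; rewrite mulrA.
Qed.

End PotentialTheory.

(** * The network associated with a chain *)

Section ChainNetwork.
Context (R : realType) (V : finType) (e : rel V).
Context (P : V -> V -> R) (mu : V -> R) (N : network R e).
Hypotheses (hG : connected_graph e) (hP : chain_on_graph e P).
Hypotheses (hirr : irreducible_chain P) (hmu : stationary_distribution P mu).
Hypothesis hN : associated_network N P mu.

Local Notation mean := (transition_mean P).

Let mu_gt0 x : 0 < mu x := stationary_gt0 hP.1 hirr hmu x.

Lemma off_graph0 (x y : V) : ~~ e x y -> P x y = 0.
Proof.
move=> nexy; apply/eqP; rewrite eq_le hP.1.1 andbT leNgt.
by apply: contra nexy => /hP.2.
Qed.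

(** The network determines the stationary flow, in each direction separately,
    although the chain need not be reversible. *)
Lemma associated_flow (x y : V) :
  e x y -> Dcond N x y * gam N x y = mu x * P x y.
Proof.
move=> exy; have eyx : e y x by rewrite hG.1.
have [-> ->] := hN exy.
have Axy : 0 < mu x * P x y by apply: mulr_gt0 => //; apply/hP.2.
have Ayx : 0 < mu y * P y x by apply: mulr_gt0 => //; apply/hP.2.
rewrite -sqrtrM; last by rewrite mulr_ge0 ?ltW.
rewrite (_ : _ * (_ / _) = (mu x * P x y) ^+ 2).
  by rewrite sqrtr_sqr gtr0_norm.
field; apply/andP; split; last by rewrite gt_eqF.
by apply: contraTneq Ayx => ->; rewrite mulr0 ltxx.
Qed.

Lemma Dcond_sym (x y : V) : e x y -> Dcond N x y = Dcond N y x.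
Proof.
move=> exy; have eyx : e y x by rewrite hG.1.
by rewrite (hN exy).1 (hN eyx).1 mulrC.
Qed.

(** The outgoing part of the current uses [P] from [x]; the incoming flow
    [mu y * P y x] sums to [mu x] by stationarity. *)
Lemma incoming_currentE (u : V -> R) (x : V) :
  incoming_current N u x = mu x * (u x - mean u x).
Proof.
have -> : incoming_current N u x =
    \sum_y (mu y * P y x * u x - mu x * P x y * u y).
  rewrite /incoming_current big_mkcond; apply: eq_bigr => y _.
  case: ifPn => [exy|nexy]; last first.
    have neyx : ~~ e y x by rewrite hG.1.
    by rewrite (off_graph0 nexy) (off_graph0 neyx) !mulr0 !mul0r subrr.
  have eyx : e y x by rewrite hG.1.
  rewrite /current mulrBr !mulrA associated_flow // Dcond_sym //.
  by rewrite associated_flow.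
rewrite sumrB -mulr_suml; have [_ _ ->] := hmu.
rewrite mulrBr /transition_mean mulr_sumr; congr (_ - _).
by apply: eq_bigr => y _; rewrite mulrA.
Qed.

Lemma total_costE (k : V -> V -> R) :
  total_cost N k = \sum_x mu x * \sum_y P x y * k x y.
Proof.
apply: eq_bigr => x _; rewrite big_mkcond mulr_sumr; apply: eq_bigr => y _.
case: ifPn => [exy|nexy]; first by rewrite associated_flow // mulrA.
by rewrite off_graph0 // mul0r mulr0.
Qed.

Section TwoVertices.
Context (a b : V) (c fa fb : V -> R).
Hypotheses (hab : a != b).
Hypotheses (hfa : hitting_equations P c a fa) (hfb : hitting_equations P c b fb).

(** Off [a] and [b] the cost terms of the two systems cancel. *)
Lemma hitting_difference_held :
  held_potentials N a b (fb a) (- fa b) (fun x => fb x - fa x).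
Proof.
case: hfa hfb => fa0 faE [fb0 fbE].
split; [by rewrite fa0 subr0 | by rewrite fb0 sub0r |].
move=> x xa xb; rewrite /free_vertex incoming_currentE transition_meanD.
by rewrite transition_meanN /= faE // fbE // (_ : _ - _ = 0) ?mulr0 //; ring.
Qed.

(** At [a] the current is [mu a * (c a + (P fa) a)]. Conservation of current for
    [fa] evaluates [mu a * (P fa) a] as the cost collected by [mu] at the other
    vertices. *)
Lemma hitting_difference_current :
  incoming_current N (fun x => fb x - fa x) a = \sum_x mu x * c x.
Proof.
case: hfa hfb => fa0 faE [fb0 fbE].
have bal := stationary_mean hmu fa.
rewrite (bigD1 a) //= [in RHS](bigD1 a) //= fa0 mulr0 add0r in bal.
rewrite [in RHS](eq_bigr (fun x => mu x * c x + mu x * mean fa x)) in bal;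
  last first.
  by move=> x xa; rewrite faE // mulrDr.
rewrite big_split /= in bal.
rewrite (bigD1 a) //= incoming_currentE transition_meanD transition_meanN.
rewrite /= fbE // fa0.
move: bal; set S := \sum_(i | _) mu i * c i; set T := \sum_(i | _) _.
move=> bal; have {bal} balS : mu a * mean fa a = S.
  by apply: (addIr T); rewrite bal addrC.
rewrite -balS; ring.
Qed.

End TwoVertices.

(** The candidate is the expected commute time [K]: the potential [g] built from
    unit costs has drop [K] and unit current. Subtracting a multiple of [g] and
    a constant from any held potential leaves one that is 0 at [a] and [b],
    hence 0 everywhere by the maximum principle. *)
Lemma effective_resistanceP (a b : V) (hab : a != b) :
  is_effective_resistance N a b (effective_resistance N a b).
Proof.
have [ha haE] := hitting_equations_solvable hP.1 hirr (fun=> 1) a.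
have [hb hbE] := hitting_equations_solvable hP.1 hirr (fun=> 1) b.
pose g x := hb x - ha x; pose K := hb a + ha b.
have K_gt0 : 0 < K.
  have ha0 := superharmonic_ge0 hP.1 hirr (fun=> ler01) haE.
  have hb0 := superharmonic_ge0 hP.1 hirr (fun=> ler01) hbE.
  rewrite /K (hbE.2 _ hab) -addrA ltr_pwDl //; apply: addr_ge0 => //.
  by apply: sumr_ge0 => y _; rewrite mulr_ge0 // hP.1.1.
have [ga gb gfree] : held_potentials N a b (hb a) (- ha b) g :=
  hitting_difference_held haE hbE.
have free_harm u x : free_vertex N u x -> u x = mean u x.
  rewrite /free_vertex incoming_currentE => /eqP.
  by rewrite mulf_eq0 gt_eqF //= subr_eq0 => /eqP.
have ig : incoming_current N g a = 1.
  rewrite (hitting_difference_current hab haE hbE).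
  have [_ mu1 _] := hmu; rewrite -[RHS]mu1.
  by apply: eq_bigr => x _; rewrite mulr1.
apply: xgetPex; exists K; split=> // Ua Ub u [<- <- ufree].
(* The scale and the constant are those that make [v] vanish at [a] and [b]. *)
pose s := (u a - u b) / K.
pose v x := u x - s * g x - (u b - s * g b).
have sK : s * K = u a - u b by rewrite /s divfK // gt_eqF.
have va : v a = 0.
  by rewrite /v ga gb; move: sK; rewrite /K => sK; lra.
have vb : v b = 0 by rewrite /v; ring.
have vmean x : mean v x = mean u x - s * mean g x - (u b - s * g b).
  rewrite /v transition_meanD (transition_meanD P u (fun y => - (s * g y))).
  rewrite (transition_meanN P (fun y => s * g y)) transition_meanZ.
  by rewrite (transition_mean_cst hP.1).
have vharm x : x != a -> x != b -> v x = mean v x.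
  move=> xa xb; rewrite vmean /v.
  by rewrite (free_harm _ _ (ufree x xa xb)) (free_harm _ _ (gfree x xa xb)).
have v_le (w : V -> R) : w a = 0 -> w b = 0 ->
    (forall x, x != a -> x != b -> w x = mean w x) -> forall x, w x <= 0.
  move=> wa wb wharm.
  apply: (maximum_principle hP.1 hirr (B := pred2 a b) (b := a)).
  - by rewrite /= eqxx.
  - by move=> x /orP[] /eqP ->; rewrite ?wa ?wb.
  - by move=> x; rewrite /= negb_or => /andP[xa xb]; rewrite -wharm.
have v0 x : v x = 0.
  apply/eqP; rewrite eq_le v_le //= -oppr_le0.
  apply: (v_le (fun y => - v y)) => [||y ya yb]; rewrite ?va ?vb ?oppr0 //.
  by rewrite transition_meanN vharm.
have := vmean a; rewrite {1}/transition_mean big1 => [|y _]; last first.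
  by rewrite v0 mulr0.
have := v0 a; rewrite /v => va' meana.
rewrite -sK mulrC; congr (_ * _).
have {va' meana} uE : u a - mean u a = s * (g a - mean g a) by lra.
by rewrite incoming_currentE uE mulrCA -incoming_currentE ig mulr1.
Qed.

Lemma hitting_difference_resistance (a b : V) (hab : a != b) (k : V -> V -> R)
    (fa fb : V -> R) :
  hitting_equations P (fun x => \sum_y P x y * k x y) a fa ->
  hitting_equations P (fun x => \sum_y P x y * k x y) b fb ->
  fb a + fa b = effective_resistance N a b * total_cost N k.
Proof.
move=> hfa hfb; have [_ Reff] := effective_resistanceP hab.
have := Reff _ _ _ (hitting_difference_held hfa hfb).
by rewrite opprK (hitting_difference_current hab hfa hfb) total_costE.
Qed.

End ChainNetwork.

(** * The law of the chain killed at the target *)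

Section KilledChain.
Context (R : realType) (V : finType) (P : V -> V -> R).
Hypotheses (hP : transition_matrix P) (hirr : irreducible_chain P).
Context (a b : V).
Hypothesis hab : a != b.

(** [killed_law t y] is the probability, from [a], to be at [y] at time [t]
    without having visited [b] so far. *)
Fixpoint killed_law (t : nat) (y : V) : R :=
  if t is t'.+1 then (y != b)%:R * \sum_x killed_law t' x * P x y
  else (y == a)%:R.

Lemma killed_law_ge0 (t : nat) (x : V) : 0 <= killed_law t x.
Proof.
elim: t x => [|t IHt] x /=; first exact: ler0n.
by apply: mulr_ge0 => //; apply: sumr_ge0 => y _; rewrite mulr_ge0 ?hP.1.
Qed.

Lemma killed_law_target (t : nat) : killed_law t b = 0.
Proof.
by case: t => [|t] /=; rewrite ?eqxx ?mul0r // eq_sym (negbTE hab).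
Qed.

(** The recursion of the killed law pairs with [f = c + P f] so that the cost of
    step [t] is the decrease of the integral of [f] from [t] to [t.+1]; the sum
    telescopes. *)
Lemma killed_law_balance (c : V -> R) (f : V -> R) (n : nat) :
  hitting_equations P c b f ->
  \sum_(t < n) \sum_x killed_law t x * c x = f a - \sum_x killed_law n x * f x.
Proof.
move=> [fb fE]; elim: n => [|n IHn].
  rewrite big_ord0 (bigD1 a) //= eqxx mul1r big1 ?addr0 ?subrr // => x xa.
  by rewrite (negbTE xa) mul0r.
suff stepE : \sum_x killed_law n.+1 x * f x =
    \sum_x killed_law n x * f x - \sum_x killed_law n x * c x.
  by rewrite big_ord_recr IHn stepE /=; ring.
rewrite -sumrB; apply/esym.
transitivity (\sum_x killed_law n x * \sum_y P x y * f y).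
  apply: eq_bigr => x _; have [->|xb] := eqVneq x b.
    by rewrite killed_law_target !mul0r subrr.
  by rewrite (fE _ xb) -mulrBr addrAC subrr add0r.
under eq_bigr do rewrite mulr_sumr; rewrite exchange_big /=.
apply: eq_bigr => y _; have [->|yb] := eqVneq y b.
  by rewrite fb big1 ?mul0r // => x _; rewrite !mulr0.
by rewrite mul1r mulr_suml; apply: eq_bigr => x _; rewrite mulrA.
Qed.

(** The balance for unit costs, whose solution is nonnegative. *)
Lemma killed_law_summable :
  exists2 C : R, 0 <= C & forall n, \sum_(t < n) \sum_x killed_law t x <= C.
Proof.
have [h hE] := hitting_equations_solvable hP hirr (fun=> 1) b.
have h0 := superharmonic_ge0 hP hirr (fun=> ler01) hE.
exists (h a) => // n.
under eq_bigr do under eq_bigr do rewrite -[killed_law _ _]mulr1.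
rewrite (killed_law_balance n hE) gerBl.
by apply: sumr_ge0 => x _; rewrite mulr_ge0 // killed_law_ge0.
Qed.

Lemma killed_mass_cvg0 : (\sum_x killed_law n x) @[n --> \oo] --> (0 : R).
Proof.
have [C C0 hC] := killed_law_summable.
apply: cvg_series_cvg_0; apply: nondecreasing_is_cvgn.
  apply: nondecreasing_series => n _ _.
  by apply: sumr_ge0 => x _; exact: killed_law_ge0.
by exists C => _ [n _ <-]; rewrite /series /= big_mkord.
Qed.

Lemma killed_law_cvg0 (x : V) : killed_law n x @[n --> \oo] --> (0 : R).
Proof.
apply: (squeeze_cvgr _ (cvg_cst 0) killed_mass_cvg0); apply: nearW => n.
rewrite killed_law_ge0 (bigD1 x) //= lerDl.
by apply: sumr_ge0 => y _; exact: killed_law_ge0.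
Qed.

Lemma killed_cost_cvg (c : V -> R) (f : V -> R) :
  hitting_equations P c b f ->
  (\sum_(t < n) \sum_x killed_law t x * c x) @[n --> \oo] --> f a.
Proof.
move=> hf; under eq_fun do rewrite (killed_law_balance _ hf).
have sum0 : (\sum_x killed_law n x * f x) @[n --> \oo] --> (0 : R).
  rewrite -[X in _ --> X](@big1 R 0 +%R V (index_enum V) xpredT
    (fun x => 0 * f x)).
    apply: cvg_big => [|x _]; first exact: add_continuous.
    by apply: cvgMr_tmp; exact: killed_law_cvg0.
  by move=> x _; rewrite mul0r.
have := cvgB (cvg_cst (f a)) sum0; rewrite subr0; apply.
Qed.

End KilledChain.

(** * Costs along a single trajectory *)

Section TruncatedCost.
Context (R : realType) (V : finType) (k : V -> V -> R) (b : V).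

Definition avoids (t : nat) (s : nat -> V) : bool :=
  [forall i : 'I_t.+1, s i != b].

(** The cost of the steps among the first [n] that start before [b] is
    visited. *)
Definition truncated_cost (n : nat) (s : nat -> V) : R :=
  \sum_(0 <= t < n | avoids t s) k (s t) (s t.+1).

(** Avoiding [b] up to time [i] means that [i] precedes the hitting time. *)
Lemma truncated_cost_eq (s : nat -> V) (t n : nat) :
  s t = b -> (t <= n)%N -> truncated_cost n s = cost_until k b s.
Proof.
move=> stb tn; rewrite /cost_until /hitting_time.
case: pselect => [h|[]]; last by exists t; apply/eqP.
case: ex_minnP => tau /eqP staub taumin.
rewrite big_add1 /= (big_nat_widen _ _ n); last first.
  by apply: leq_trans tn; apply: taumin; apply/eqP.
apply: eq_bigl => i /=; apply/forallP/idP => [av|itau j].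
  rewrite ltnNge; apply/negP => taui.
  by have := av (Ordinal (taui : tau < i.+1)%N); rewrite /= staub eqxx.
apply/negP => /taumin; rewrite leqNgt => /negP; apply.
exact: leq_trans (ltn_ord j) itau.
Qed.

End TruncatedCost.

(** * Finitely many coordinates of a Markov chain *)

Section FiniteValued.
Context (R : realType) (d : measure_display) (Omega : measurableType d).

Lemma measurable_event (I : finType) (Z : Omega -> I) (A : set I) :
  (forall i, measurable (Z @^-1` [set i])) -> measurable (Z @^-1` A).
Proof.
move=> mZ; have -> : Z @^-1` A = \bigcup_(i in A) Z @^-1` [set i].
  apply/seteqP; split=> [w Aw|w [i Ai /= ->] //]; by exists (Z w).
by apply: fin_bigcup_measurable => //; exact: finite_finset.
Qed.

Lemma total_probability (mu : {measure set Omega -> \bar R}) (I : finType)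
    (Z : Omega -> I) (F : set Omega) :
  (forall i, measurable (Z @^-1` [set i])) -> measurable F ->
  mu F = (\sum_i mu (F `&` Z @^-1` [set i]))%E.
Proof.
move=> mZ mF.
have -> : mu F = mu (\bigcup_(i in [set: I]) (F `&` Z @^-1` [set i])).
  congr (mu _); apply/seteqP; split=> [w Fw|w [i _ [] //]].
  by exists (Z w).
rewrite measure_fin_bigcup; last 3 first.
- exact: finite_finset.
- by move=> i j _ _ [w [[_ /= <-] [_ /= <-]]].
- by move=> i _; exact: measurableI.
rewrite (@fsbigE _ _ _ _ _ (index_enum I)) //.
- by apply: eq_bigl => i; rewrite in_setT.
- exact: index_enum_uniq.
- by move=> i _; rewrite mem_index_enum.
Qed.

End FiniteValued.

Section MarkovChain.
Context (R : realType) (V : finType) (P : V -> V -> R).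
Hypotheses (hP : transition_matrix P) (hirr : irreducible_chain P).
Context (d : measure_display) (Omega : measurableType d).
Context (Pr : probability Omega R) (X : nat -> Omega -> V) (a b : V).
Hypotheses (hX : markov_chain_from P Pr X a) (hab : a != b).

Let measurable_X (t : nat) (A : set V) : measurable (X t @^-1` A).
Proof. by apply: measurable_event; case: hX. Qed.

Definition initial_path (n : nat) (w : Omega) : {ffun 'I_n.+1 -> V} :=
  [ffun i : 'I_n.+1 => X i w].

Lemma measurable_initial_path (n : nat) (A : set {ffun 'I_n.+1 -> V}) :
  measurable (initial_path n @^-1` A).
Proof.
apply: measurable_event => p.
have -> : initial_path n @^-1` [set p] =
    \bigcap_(i in [set: 'I_n.+1]) X i @^-1` [set p i].
  apply/seteqP; split=> [w /= <- i _ /=|w hw /=]; first by rewrite ffunE.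
  by apply/ffunP => i; rewrite ffunE; exact: hw.
apply: fin_bigcap_measurable; first exact: finite_finset.
by move=> i _; exact: measurable_X.
Qed.

(** The Markov property for an event that depends on the first [n.+1]
    coordinates and fixes the last of them: split it into single paths. *)
Lemma markov_step (n : nat) (A : pred {ffun 'I_n.+1 -> V}) (x y : V) :
  (forall p, A p -> p ord_max = x) ->
  Pr ([set w | A (initial_path n w)] `&` X n.+1 @^-1` [set y]) =
  (Pr [set w | A (initial_path n w)] * (P x y)%:E)%E.
Proof.
move=> Ax; have [_ _ markov] := hX.
have mA : measurable [set w | A (initial_path n w)].
  exact: (measurable_initial_path [set p | A p]).
have mpath p : measurable (initial_path n @^-1` [set p]).
  exact: measurable_initial_path.
rewrite (total_probability Pr mpath (measurableI _ _ mA (measurable_X _ _))).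
rewrite [in RHS](total_probability Pr mpath mA).
rewrite ge0_sume_distrl => [|p _]; last exact: measure_ge0.
apply: eq_bigr => p _; case Ap: (A p); last first.
  have A0 : [set w | A (initial_path n w)] `&` initial_path n @^-1` [set p] = set0.
    by rewrite -subset0 => w [/= + pE]; rewrite pE Ap.
  by rewrite setIAC A0 set0I measure0 mul0e.
(* The path [p], continued by [y] at time [n.+1]. *)
pose s t := if (t <= n)%N then p (inord t) else y.
have sE : forall w, (forall t, (t <= n)%N -> X t w = s t) <->
    initial_path n w = p.
  move=> w; split=> [sw|wp t tn].
    apply/ffunP => i; rewrite ffunE sw ?leq_ord // /s leq_ord.
    by rewrite inord_val.
  by rewrite /s tn -wp ffunE inordK.
have sn : s n = x.
  rewrite /s leqnn -(Ax _ Ap); congr (p _).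
  by apply: val_inj; rewrite /= inordK.
have sn1 : s n.+1 = y by rewrite /s ltnn.
have stepE := markov n s; rewrite sn sn1 in stepE.
transitivity (Pr [set w | forall t, (t <= n.+1)%N -> X t w = s t]).
  congr (Pr _); apply/seteqP; split=> [w [[_ /= yE] /sE sw] t|w /= sw].
    rewrite leq_eqVlt ltnS => /predU1P[->|]; last exact: sw.
    by rewrite yE sn1.
  have pE : initial_path n w = p by apply/sE => t tn; apply: sw; exact: leqW.
  by rewrite pE; split=> //; split=> //=; rewrite sw.
rewrite stepE; congr (Pr _ * _)%E; apply/seteqP; split=> [w /sE pE|w [_ /sE]//].
by split=> //=; rewrite pE.
Qed.

Definition survives (t : nat) : set Omega := [set w | avoids b t (X^~ w)].

Lemma survivesE (t : nat) :
  survives t = [set w | [forall i, initial_path t w i != b]].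
Proof.
by apply/seteqP; split=> w /= /forallP av; apply/forallP => i;
  have := av i; rewrite ffunE.
Qed.

Lemma measurable_survives (t : nat) : measurable (survives t).
Proof.
rewrite survivesE.
exact: (measurable_initial_path [set p : {ffun _ -> _} | [forall i, p i != b]]).
Qed.

Let measurable_survives_at (t : nat) (A : set V) :
  measurable (survives t `&` X t @^-1` A).
Proof. exact: measurableI (measurable_survives t) (measurable_X t A). Qed.

Lemma survives_step (t : nat) (x y : V) :
  Pr (survives t `&` X t @^-1` [set x] `&` X t.+1 @^-1` [set y]) =
  (Pr (survives t `&` X t @^-1` [set x]) * (P x y)%:E)%E.
Proof.
have -> : survives t `&` X t @^-1` [set x] = [set w |
    [forall i, initial_path t w i != b] && (initial_path t w ord_max == x)].
  rewrite survivesE; apply/seteqP; split=> w /=.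
    by move=> [-> <-]; rewrite ffunE eqxx.
  by move=> /andP[-> /eqP <-]; rewrite ffunE.
apply: (@markov_step t
  [pred p : {ffun _ -> _} | [forall i, p i != b] && (p ord_max == x)]).
by move=> p /andP[_ /eqP].
Qed.

(** The recursion is obtained by splitting over the position at time [t]. At
    time 0 the start is [a] almost surely, and [a] differs from [b]. *)
Lemma survives_law (t : nat) (y : V) :
  Pr (survives t `&` X t @^-1` [set y]) = (killed_law P a b t y)%:E.
Proof.
elim: t y => [|t IHt] y /=.
  have [_ X0 _] := hX; have [->|ya] := eqVneq y a.
    rewrite -X0; congr (Pr _); apply/seteqP; split=> [w [_ //]|w /= wa].
    by split=> //; apply/forallP => i; rewrite ord1 wa.
  apply/eqP; rewrite eq_le measure_ge0 andbT.
  have Xa0 : Pr (~` (X 0%N @^-1` [set a])) = 0%E.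
    by rewrite probability_setC ?X0 ?subee //; exact: measurable_X.
  rewrite -[_%:E]/(0%E) -Xa0; apply: le_measure; rewrite ?inE //.
    by apply: measurableC; exact: measurable_X.
  by move=> w [_ /= ->]; apply/eqP.
have [->|yb] := eqVneq y b.
  rewrite mul0r -[RHS](measure0 Pr); congr (Pr _).
  rewrite -subset0.
  by move=> w [/forallP /(_ ord_max) /= /eqP].
rewrite (total_probability Pr (fun x => measurable_X t [set x])
  (measurable_survives_at _ _)).
rewrite mul1r -sumEFin; apply: eq_bigr => x _.
rewrite EFinM -IHt -survives_step; congr (Pr _).
apply/seteqP; split=> w.
  move=> [[/forallP av /= Xy] Xx]; split=> //; split=> //.
  by apply/forallP => i; exact: (av (widen_ord (leqnSn t.+1) i)).
move=> [[/forallP av Xx] /= Xy]; split=> //; split=> //.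
apply/forallP => i; have := ltn_ord i; rewrite ltnS leq_eqVlt => /predU1P[->|it].
  by rewrite Xy.
exact: (av (Ordinal it)).
Qed.

Lemma survival_probability (t : nat) :
  Pr (survives t) = (\sum_x killed_law P a b t x)%:E.
Proof.
rewrite (total_probability Pr (fun x => measurable_X t [set x])
  (measurable_survives t)).
by rewrite -sumEFin; apply: eq_bigr => x _; exact: survives_law.
Qed.

(** * The expected cost of reaching the target *)

Definition surviving_transition (t : nat) (z : V * V) : set Omega :=
  survives t `&` X t @^-1` [set z.1] `&` X t.+1 @^-1` [set z.2].

Lemma measurable_surviving_transition (t : nat) (z : V * V) :
  measurable (surviving_transition t z).
Proof. exact: measurableI (measurable_survives_at _ _) (measurable_X _ _). Qed.

(** Writing the cost as a finite combination of indicators yields both its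
    measurability and its expectation. *)
Lemma truncated_cost_indic (k : V -> V -> R) (n : nat) (w : Omega) :
  truncated_cost k b n (X^~ w) =
  \sum_(t < n) \sum_z k z.1 z.2 * \1_(surviving_transition t z) w.
Proof.
rewrite /truncated_cost big_mkcond big_mkord; apply: eq_bigr => t _.
rewrite (bigD1 (X t w, X t.+1 w)) //= big1 => [|z /eqP zw]; last first.
  rewrite indicE memNset ?mulr0 // => -[[_ /= z1] z2]; apply: zw.
  by rewrite z1 z2; case: z {z1 z2}.
rewrite addr0 indicE; case: ifPn => av.
  by rewrite mem_set ?mulr1.
by rewrite memNset ?mulr0 // => -[[/=]]; rewrite /survives /= (negbTE av).
Qed.

Lemma measurable_truncated_cost (k : V -> V -> R) (n : nat) :
  measurable_fun setT (fun w => truncated_cost k b n (X^~ w)).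
Proof.
under eq_fun do rewrite truncated_cost_indic.
apply: measurable_sum => t; apply: measurable_sum => z.
apply: measurable_funM; first exact: measurable_cst.
exact: measurable_indic (measurable_surviving_transition t z).
Qed.

Lemma integral_truncated_cost (k : V -> V -> R) (n : nat) :
  (\int[Pr]_w (truncated_cost k b n (X^~ w))%:E)%E =
  (\sum_(t < n) \sum_x killed_law P a b t x * \sum_y P x y * k x y)%:E.
Proof.
have int_z t (z : V * V) : Pr.-integrable setT
    (fun w => ((k z.1 z.2)%:E * (\1_(surviving_transition t z) w)%:E)%E).
  apply: integrableZl => //; apply: integrable_indic.
  exact: measurable_surviving_transition.
under eq_integral => w _.
  rewrite truncated_cost_indic -sumEFin.
  under eq_bigr => t _.
    rewrite -sumEFin.
    under eq_bigr do rewrite EFinM.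
    over.
  over.
rewrite integral_sum //; last by move=> t; exact: integrable_sum.
rewrite -sumEFin; apply: eq_bigr => t _.
rewrite integral_sum //.
rewrite -(pair_bigA _ (fun x y => (\int[Pr]_w
  ((k x y)%:E * (\1_(surviving_transition t (x, y)) w)%:E))%E)) /=.
rewrite -sumEFin; apply: eq_bigr => x _.
rewrite mulr_sumr -sumEFin; apply: eq_bigr => y _.
rewrite integralZl //; last first.
  by apply: integrable_indic; exact: measurable_surviving_transition.
rewrite integral_indic //; last exact: measurable_surviving_transition.
rewrite setIT /surviving_transition /= survives_step survives_law.
by rewrite -!EFinM; congr (_%:E); ring.
Qed.

(** The survival probabilities, which bound the probability of never reaching
    [b], are the masses of the killed law and tend to 0. *)
Lemma survives_all_null : Pr.-negligible [set w | forall t, X t w != b].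
Proof.
pose A := \bigcap_t survives t.
have mA : measurable A by apply: bigcapT_measurable => t;
    exact: measurable_survives.
apply: (@negligibleS _ _ _ _ A) => [w nb t _|]; first by apply/forallP.
apply/negligibleP => //.
have A_le t : fine (Pr A) <= \sum_x killed_law P a b t x.
  rewrite -lee_fin fineK ?fin_num_measure // -survival_probability.
  apply: le_measure; rewrite ?inE //; first exact: measurable_survives.
  by move=> w; exact.
have A_le0 : fine (Pr A) <= 0.
  have cvg0 := killed_mass_cvg0 hP hirr hab.
  have <- := cvg_lim (@Rhausdorff R) cvg0.
  apply: limr_ge; first by apply/cvg_ex; exists 0.
  exact: nearW.
apply/eqP; rewrite eq_le measure_ge0 andbT.
by rewrite -(fineK (fin_num_measure Pr A mA)) lee_fin.
Qed.

Lemma le_truncated_cost (k : V -> V -> R) (n : nat) (w : Omega) :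
  `|truncated_cost k b n (X^~ w)| <=
  \sum_(t < n) (\sum_x \sum_y `|k x y|) * \1_(survives t) w.
Proof.
rewrite /truncated_cost big_mkcond big_mkord.
apply: (le_trans (ler_norm_sum _ _ _)); apply: ler_sum => t _.
case: ifPn => av; last first.
  by rewrite normr0 mulr_ge0 // sumr_ge0 // => x _; rewrite sumr_ge0.
rewrite indicE mem_set // mulr1 (bigD1 (X t w)) //= (bigD1 (X t.+1 w)) //=.
rewrite -addrA lerDl addr_ge0 ?sumr_ge0 // => x _; exact: sumr_ge0.
Qed.

Lemma truncated_cost_cvg (k : V -> V -> R) (w : Omega) (t : nat) :
  X t w = b ->
  truncated_cost k b n (X^~ w) @[n --> \oo] --> cost_until k b (X^~ w).
Proof.
move=> Xtb; apply: cvg_near_cst; near=> n.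
apply: (truncated_cost_eq _ Xtb); near: n; exact: nbhs_infty_ge.
Unshelve. all: by end_near. Qed.

(** On trajectories that reach [b] the truncated costs converge to the cost; on
    the others the cost is 0, so the truncated costs are cut off there. *)
Lemma measurable_cost_until (k : V -> V -> R) :
  measurable_fun setT (fun w => cost_until k b (X^~ w)).
Proof.
pose H := ~` \bigcap_t survives t.
have mH : measurable H.
  by apply: measurableC; apply: bigcapT_measurable => t;
    exact: measurable_survives.
apply: (@measurable_fun_cvg _ _ _ _
  (fun n w => truncated_cost k b n (X^~ w) * \1_H w)).
  move=> n; apply: measurable_funM; first exact: measurable_truncated_cost.
  exact: measurable_indic.
move=> w _; have [[t Xtb]|nb] := pselect (exists t, X t w = b).
  rewrite indicE mem_set; last first.
    by move=> /(_ t I) /forallP /(_ ord_max) /=; rewrite Xtb eqxx.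
  under eq_fun do rewrite mulr1.
  exact: truncated_cost_cvg Xtb.
rewrite indicE memNset; last first.
  move=> nall; apply: nall => t _; apply/forallP => i; apply/eqP => Xib.
  by apply: nb; exists i.
under eq_fun do rewrite mulr0.
rewrite /cost_until /hitting_time; case: pselect => [h|_].
  by case: nb; case: h => t /eqP Xtb; exists t.
exact: cvg_cst.
Qed.

Lemma expected_cost_until (k : V -> V -> R) (f : V -> R) :
  hitting_equations P (fun x => \sum_y P x y * k x y) b f ->
  ('E_Pr[fun w => cost_until k b (X^~ w)] = (f a)%:E)%E.
Proof.
move=> hf; rewrite unlock.
(* [g] is a bound for one step times the number of steps before [b] is
   reached; its expectation is finite since the killed law is summable. *)
pose M := \sum_x \sum_y `|k x y|.
have M0 : 0 <= M by apply: sumr_ge0 => x _; exact: sumr_ge0.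
pose g w := (\sum_(0 <= t <oo) (M * \1_(survives t) w)%:E)%E.
have g0 t w : (0 <= (M * \1_(survives t) w)%:E)%E by rewrite lee_fin mulr_ge0.
have mg t : measurable_fun setT (fun w => (M * \1_(survives t) w)%:E).
  apply/measurable_EFinP; apply: measurable_funM; first exact: measurable_cst.
  exact: measurable_indic (measurable_survives t).
have int_survives t : (\int[Pr]_w (M * \1_(survives t) w)%:E =
    (M * \sum_x killed_law P a b t x)%:E)%E.
  under eq_integral do rewrite EFinM.
  rewrite integralZl //; last first.
    by apply: integrable_indic; exact: measurable_survives.
  rewrite integral_indic //; last exact: measurable_survives.
  by rewrite setIT [X in (_ * X)%E]survival_probability -EFinM.
have int_g : Pr.-integrable setT g.
  apply/integrableP; split; first exact: ge0_emeasurable_sum.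
  under eq_integral => w _ do rewrite gee0_abs ?nneseries_ge0 //.
  rewrite integral_nneseries //.
  have [C C0 hC] := killed_law_summable hP hirr hab.
  apply: (@le_lt_trans _ _ (M * C)%:E); last exact: ltry.
  apply: lime_le.
    by apply: is_cvg_nneseries => t _ _; exact: integral_ge0.
  apply: nearW => n; rewrite big_mkord.
  under eq_bigr do rewrite int_survives.
  by rewrite sumEFin lee_fin -mulr_sumr ler_wpM2l.
have ae_cvg : {ae Pr, forall w, [set: Omega] w ->
    (truncated_cost k b n (X^~ w))%:E @[n --> \oo] -->
    (cost_until k b (X^~ w))%:E}.
  apply: negligibleS survives_all_null => w /= ncvg t.
  apply/eqP => Xtb; apply: ncvg => _.
  by apply: cvg_EFin; [exact: nearW|exact: truncated_cost_cvg Xtb].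
have le_g n w : (`|(truncated_cost k b n (X^~ w))%:E| <= g w)%E.
  apply: (@le_trans _ _ (\sum_(0 <= t < n) (M * \1_(survives t) w)%:E)%E).
    by rewrite big_mkord sumEFin abse_EFin lee_fin le_truncated_cost.
  exact: nneseries_lim_ge.
have [_ _ cvgE] := @dominated_convergence _ _ _ Pr setT measurableT
  (fun n w => (truncated_cost k b n (X^~ w))%:E)
  (fun w => (cost_until k b (X^~ w))%:E) g
  (fun n => (measurable_EFinP _ _).2 (measurable_truncated_cost k n))
  ((measurable_EFinP _ _).2 (measurable_cost_until k))
  ae_cvg int_g (aeW _ (fun w n _ => le_g n w)).
have cvg_fa : (\int[Pr]_w (truncated_cost k b n (X^~ w))%:E)%E @[n --> \oo] -->
    (f a)%:E.
  under eq_fun do rewrite integral_truncated_cost.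
  by apply: cvg_EFin; [exact: nearW|exact: killed_cost_cvg hf].
exact: cvg_unique cvgE cvg_fa.
Qed.

End MarkovChain.

Theorem theorem3p12 (R : realType) (V : finType) (e : rel V)
    (P : V -> V -> R) (mu : V -> R) (N : network R e)
    (d : measure_display) (Omega : measurableType d)
    (Pr : V -> probability Omega R) (X : nat -> Omega -> V)
    (a b : V) (k : V -> V -> R)
    (hG : connected_graph e)
    (hP : chain_on_graph e P)
    (hirr : irreducible_chain P)
    (hmu : stationary_distribution P mu)
    (hN : associated_network N P mu)
    (hX : markov_family P Pr X)
    (hab : a != b) :
  commute_cost Pr X k a b =
    (effective_resistance N a b * total_cost N k)%R%:E.
Proof.
pose c x := \sum_y P x y * k x y.
have [fa faE] := hitting_equations_solvable hP.1 hirr c a.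
have [fb fbE] := hitting_equations_solvable hP.1 hirr c b.
have hba : b != a by rewrite eq_sym.
rewrite /commute_cost /hitting_cost.
rewrite (expected_cost_until hP.1 hirr (hX a) hab fbE).
rewrite (expected_cost_until hP.1 hirr (hX b) hba faE) -EFinD.
by rewrite (hitting_difference_resistance hG hP hirr hmu hN hab faE fbE).
Qed.
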